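(* Let $G=(K,I)$ be a connected claw-free split graph of order $n$, where $|I|\ge 1$ and $n\ge \max\{4, 2|I|\}$. If $\rho(G)\ge \rho(G_{n,|I|})$, then $G$ is Hamiltonian, unless $G\cong G_{n,|I|}$.
   Context: All graphs are finite and simple. A split graph $G=(K,I)$ is a graph whose vertex set is partitioned into a clique $K$ and an independent set $I$, where $K$ is chosen to be a maximum clique of $G$. A graph is claw-free if it has no induced subgraph isomorphic to $K_{1,3}$. $\rho(G)$ denotes the spectral radius (largest eigenvalue) of the adjacency matrix of $G$. A graph is Hamiltonian if it has a cycle through all its vertices. For integers $n\ge 4$ and $1\le t\le n/2$, $G_{n,t}$ is the graph obtained from the disjoint union of a complete graph $K_{n-t}$ with vertices $v_1,\dots,v_{n-t}$ and $t$ isolated vertices $u_1,\dots,u_t$ as follows: if $t=1$, add the edge $u_1v_1$; if $t\ge 2$, add the edges $u_iv_i$ for $i=1,\dots,t-1$ and the edges $u_tv_j$ for $j=t,\dots,n-t$. *)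

(* Defs.v *)
From HB Require Import structures.
From mathcomp Require Import all_boot all_order all_algebra.
From mathcomp Require Import classical_sets reals.

Set Implicit Arguments.
Unset Strict Implicit.
Unset Printing Implicit Defensive.

Import Order.TTheory GRing.Theory Num.Theory.

(* A finite simple graph is a symmetric irreflexive relation on a finType. *)
Definition simple_graph (T : finType) (e : rel T) : Prop :=
  symmetric e /\ irreflexive e.

Definition connected_graph (T : finType) (e : rel T) : Prop :=
  forall x y : T, connect e x y.

Definition graph_iso (T U : finType) (e : rel T) (f : rel U) : Prop :=
  exists2 h : T -> U, bijective h & forall x y, f (h x) (h y) = e x y.

Definition has_induced (U T : finType) (f : rel U) (e : rel T) : Prop :=
  exists2 h : U -> T, injective h & forall x y, e (h x) (h y) = f x y.

(* K_{1,3} on {0, 1, 2, 3}, with centre 0. *)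
Definition claw : rel 'I_4 := [rel i j | (i == ord0) != (j == ord0)].

Definition claw_free (T : finType) (e : rel T) : Prop := ~ has_induced claw e.

Definition clique (T : finType) (e : rel T) (A : {set T}) : Prop :=
  {in A &, forall x y, x != y -> e x y}.

Definition independent (T : finType) (e : rel T) (A : {set T}) : Prop :=
  {in A &, forall x y, ~~ e x y}.

Definition maximum_clique (T : finType) (e : rel T) (A : {set T}) : Prop :=
  clique e A /\ forall B : {set T}, clique e B -> #|B| <= #|A|.

Definition split_graph (T : finType) (e : rel T) (K I : {set T}) : Prop :=
  [/\ K :|: I = [set: T], [disjoint K & I],
      maximum_clique e K & independent e I].

Definition hamiltonian (T : finType) (e : rel T) : Prop :=
  exists c : seq T, [/\ 2 < size c, ucycle e c & forall x, x \in c].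

Definition adjacency (R : realType) (T : finType) (e : rel T) : 'M[R]_#|T| :=
  (\matrix_(i, j) (e (enum_val i) (enum_val j))%:R)%R.

(* For a simple graph with at least one vertex the set of real eigenvalues is
   finite and nonempty (the matrix is real symmetric), so this supremum is the
   largest eigenvalue. *)
Definition spectral_radius (R : realType) (T : finType) (e : rel T) : R :=
  sup [set x : R | eigenvalue (adjacency R e) x]%classic.

(* G_{n,t}: [inl i] is v_(i+1) and [inr j] is u_(j+1). [Gnt_uv t j i] is the
   adjacency of u_j and v_i, with both indices counted from 1. *)
Definition Gnt_uv (t j i : nat) : bool :=
  if t == 1 then i == 1 else if j < t then i == j else t <= i.

Definition Gnt (n t : nat) : rel ('I_(n - t) + 'I_t) :=
  fun x y => match x, y with
  | inl i, inl i' => i != i'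
  | inl i, inr j | inr j, inl i => Gnt_uv t j.+1 i.+1
  | inr _, inr _ => false
  end.
Arguments Gnt : clear implicits.

Lemma Gnt_simple (n t : nat) : simple_graph (Gnt n t).
Proof.
by split=> [[i|j] [i'|j']|[i|j]] //=; rewrite ?eqxx // eq_sym.
Qed.

(* Main.v *)
(** If some clique vertex has two neighbours in [I], claw-freeness makes these
    two neighbourhoods cover [K] and bounds [#|I|] by 3, and a Hamiltonian cycle
    can be written down. Otherwise the neighbourhoods of the vertices of [I] are
    disjoint, and eliminating the clique coordinates of an eigenvector shows that
    the spectral radius is the unique root [x >= k - 1] of
      [x + 1 - k = \sum_(u in I) d_u^2 / (x (x + 1) - d_u)],
    where [k = #|K|] and [d_u] is the degree of [u]. The right-hand side decreases
    in [x] and is convex in the degrees, so over all degree sequences with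
    [d_u >= 1] and sum at most [k] it is maximal exactly when a single vertex
    carries all the excess, which is the degree sequence of [Gnt]. Hence for
    [#|I| >= 2] the spectral hypothesis already forces the isomorphism. *)
Require Import Defs.
From HB Require Import structures.
From mathcomp Require Import all_boot all_order all_algebra.
From mathcomp Require Import classical_sets reals.
From mathcomp Require Import zify ring lra.

Set Implicit Arguments.
Unset Strict Implicit.
Unset Printing Implicit Defensive.

Import Order.TTheory GRing.Theory Num.Theory.
Local Open Scope ring_scope.

(** * Eigenvectors as functions on the vertices *)

(** Row vectors are read as functions on [T] through [enum_rank]; symmetry of [e] turns left
    multiplication into the sum over the neighbours of [y]. *)
Lemma eigenvalue_adjacencyP (R : realType) (T : finType) (e : rel T) (a : R) :
  symmetric e ->
  eigenvalue (adjacency R e) a <->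
  exists2 f : T -> R, exists z, f z != 0 &
    forall y, \sum_x (e y x)%:R * f x = a * f y.
Proof.
move=> se.
have sumE (w : 'rV[R]_#|T|) (i : 'I_#|T|) : (w *m adjacency R e) 0 i =
    \sum_x (e (enum_val i) x)%:R * w 0 (enum_rank x).
  rewrite mxE (reindex enum_rank) /=; last first.
    exact: onW_bij (enum_rank_bij T).
  by apply: eq_bigr => x _; rewrite mxE enum_rankK mulrC se.
split.
  case/eigenvalueP=> w Hw /rV0Pn w0.
  exists (fun x => w 0 (enum_rank x)).
    by case: w0 => i wi; exists (enum_val i); rewrite enum_valK.
  move=> y; have := sumE w (enum_rank y).
  by rewrite Hw mxE enum_rankK => ->.
case=> f [z fz] Hf; apply/eigenvalueP; exists (\row_i f (enum_val i)).
  apply/rowP=> i; rewrite sumE !mxE -Hf.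
  by apply: eq_bigr => x _; rewrite mxE enum_rankK.
apply/rV0Pn; exists (enum_rank z).
by rewrite mxE enum_rankK.
Qed.

(** * Disjoint neighbourhoods in [K] and the secular equation *)

(** The common setting in which the spectral radii of both [G] and [Gnt] are computed. *)
Definition disjoint_split (T : finType) (e : rel T) (K I : {set T}) : Prop :=
  [/\ simple_graph e, K :|: I = [set: T] /\ [disjoint K & I],
      clique e K, independent e I &
      forall v u u', v \in K -> u \in I -> u' \in I -> e v u -> e v u' -> u = u'].

Definition clique_deg (T : finType) (e : rel T) (K : {set T}) (u : T) : nat :=
  #|[set v in K | e u v]|.

Lemma clique_degE (R : realType) (T : finType) (e : rel T) (K : {set T}) (u : T) :
  (clique_deg e K u)%:R = \sum_(v in K) (e u v)%:R :> R.
Proof.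
rewrite -natr_sum /clique_deg -sum1_card big_mkcond [in RHS]big_mkcond /=.
by congr _%:R; apply: eq_bigr => v _; rewrite inE; case: (v \in K); case: (e u v).
Qed.

Lemma sum_split (V : nmodType) (T : finType) (K I : {set T}) (F : T -> V) :
  K :|: I = [set: T] -> [disjoint K & I] ->
  \sum_x F x = \sum_(v in K) F v + \sum_(u in I) F u.
Proof.
move=> KI dKI; rewrite -bigU //=; apply: eq_bigl => x.
by have := finset.in_setT x; rewrite -KI !inE => ->.
Qed.

Lemma sum_clique_nbhd (R : realType) (T : finType) (e : rel T) (K I : {set T})
    (f : T -> R) (v : T) :
  disjoint_split e K I -> v \in K ->
  \sum_x (e v x)%:R * f x =
    \sum_(w in K) f w - f v + \sum_(u in I) (e v u)%:R * f u.
Proof.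
case=> [[_ ir] [KI dKI] cK _ _] vK; rewrite (sum_split _ KI dKI); congr (_ + _).
rewrite (bigD1 v) //= ir mul0r add0r [in RHS](bigD1 v) //= addrAC subrr add0r.
apply: eq_bigr => w /andP[wK wv].
by rewrite cK ?mul1r // eq_sym.
Qed.

Lemma sum_independent_nbhd (R : realType) (T : finType) (e : rel T)
    (K I : {set T}) (f : T -> R) (u : T) :
  disjoint_split e K I -> u \in I ->
  \sum_x (e u x)%:R * f x = \sum_(v in K) (e u v)%:R * f v.
Proof.
case=> [_ [KI dKI] _ iI _] uI; rewrite (sum_split _ KI dKI).
rewrite [X in _ + X]big1 ?addr0 // => w wI.
by rewrite (negbTE (iI _ _ uI wI)) mul0r.
Qed.

Lemma sum_clique_sum_independent (R : realType) (T : finType) (e : rel T)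
    (K I : {set T}) (f : T -> R) :
  symmetric e ->
  \sum_(v in K) \sum_(u in I) (e v u)%:R * f u =
  \sum_(u in I) (clique_deg e K u)%:R * f u.
Proof.
move=> se; rewrite exchange_big; apply: eq_bigr => u _ /=.
rewrite clique_degE mulr_suml; apply: eq_bigr => v _.
by rewrite se.
Qed.

(* Only the term [u' = u] survives, because no clique vertex sees two vertices
   of [I]. *)
Lemma sum_nbhd_sum_independent (R : realType) (T : finType) (e : rel T)
    (K I : {set T}) (f : T -> R) (u : T) :
  disjoint_split e K I -> u \in I ->
  \sum_(v in K) (e u v)%:R * \sum_(u' in I) (e v u')%:R * f u' =
  (clique_deg e K u)%:R * f u.
Proof.
case=> [[se _] _ _ _ dj] uI; rewrite clique_degE mulr_suml.
apply: eq_bigr => v vK; case euv: (e u v); rewrite ?mul0r // !mul1r.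
rewrite (bigD1 u) //= se euv mul1r big1 ?addr0 // => u' /andP[u'I u'u].
case evu': (e v u'); rewrite ?mul0r //.
by rewrite (dj v u' u) ?eqxx // se in u'u.
Qed.

(** Count the edges between [K] and [I] from the side of [K], where each vertex contributes at most
    one. *)
Lemma sum_clique_deg_le (T : finType) (e : rel T) (K I : {set T}) :
  disjoint_split e K I -> (\sum_(u in I) clique_deg e K u <= #|K|)%N.
Proof.
case=> [[se _] _ _ _ dj].
have -> : (\sum_(u in I) clique_deg e K u = \sum_(v in K) #|[set u in I | e v u]|)%N.
  under eq_bigr do rewrite /clique_deg -sum1_card big_mkcond /=.
  under [in RHS]eq_bigr do rewrite -sum1_card big_mkcond /=.
  rewrite [in LHS]big_mkcond [in RHS]big_mkcond /=.
  under eq_bigr do rewrite -[X in if _ then X else _]big_mkcond.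
  under [in RHS]eq_bigr do rewrite -[X in if _ then X else _]big_mkcond.
  rewrite -2!big_mkcond /= (exchange_big_dep (mem K)) /=; last first.
    by move=> u v _; rewrite inE => /andP[].
  apply: eq_bigr => v vK; apply: eq_bigl => u; rewrite !inE vK se.
  by case: (u \in I).
rewrite -sum1_card; apply: leq_sum => v vK.
apply/card_le1_eqP => u u'; rewrite !inE => /andP[uI eu] /andP[u'I eu'].
exact: (dj v).
Qed.

(* Eliminating the clique coordinates of an eigenvector for [x] leaves
   [x_u (x (x + 1) - d_u) = d_u S] with [S] the sum over the clique, and summing
   the clique equations then gives the equation [secular e K I x = x + 1 - #|K|]. *)
Definition secular (R : realType) (T : finType) (e : rel T) (K I : {set T}) (x : R) : R :=
  \sum_(u in I) (clique_deg e K u)%:R ^+ 2 / (x * (x + 1) - (clique_deg e K u)%:R).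

Lemma eigenvalue_secular (R : realType) (T : finType) (e : rel T)
    (K I : {set T}) (x : R) :
  disjoint_split e K I -> 0 <= x ->
  {in I, forall u, (clique_deg e K u)%:R < x * (x + 1)} ->
  eigenvalue (adjacency R e) x <-> secular e K I x = x + 1 - #|K|%:R.
Proof.
move=> dsp x0 dx; have [[se ir] [KI dKI] cK iI dj] := dsp.
have x1 : x + 1 != 0 by lra.
have den u : u \in I -> x * (x + 1) - (clique_deg e K u)%:R != 0.
  by move=> /dx; lra.
rewrite eigenvalue_adjacencyP //; split.
  case=> f [z fz] Hf; pose S := \sum_(v in K) f v.
  have fK v : v \in K -> (x + 1) * f v = S + \sum_(u in I) (e v u)%:R * f u.
    by move=> vK; have := Hf v; rewrite (sum_clique_nbhd f dsp vK) -/S; lra.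
  have fI u : u \in I ->
      f u = (clique_deg e K u)%:R * S / (x * (x + 1) - (clique_deg e K u)%:R).
    move=> uI; apply/eqP; rewrite -(inj_eq (mulIf (den _ uI))) divfK ?den //; apply/eqP.
    (* Multiply the equation at [u] by [x + 1] and substitute the clique equations [fK]. *)
    have : (x + 1) * (x * f u) = (clique_deg e K u)%:R * (S + f u).
      rewrite -Hf (sum_independent_nbhd f dsp uI) mulr_sumr.
      rewrite mulrDr -(sum_nbhd_sum_independent f dsp uI) clique_degE mulr_suml -big_split /=.
      by apply: eq_bigr => v vK; rewrite mulrCA fK // mulrDr.
    by lra.
  (* If the clique sum vanished, [fI] and then [fK] would make [f] zero everywhere. *)
  have S0 : S != 0.
    apply: contraNneq fz => S0.
    have fI0 u : u \in I -> f u = 0 by move=> uI; rewrite fI // S0 mulr0 mul0r.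
    have : z \in K :|: I by rewrite KI inE.
    case/setUP=> [zK|/fI0->] //.
    have := fK _ zK; rewrite S0 big1 ?addr0 => [/eqP|u uI].
      by rewrite mulf_eq0 (negbTE x1).
    by rewrite fI0 ?mulr0.
  apply: (mulIf S0).
  have : (x + 1) * S = #|K|%:R * S + \sum_(u in I) (clique_deg e K u)%:R * f u.
    rewrite -(sum_clique_sum_independent K I f se) mulr_sumr.
    rewrite -[#|K|%:R * S]mulrC mulr_natr -sumr_const -big_split /=.
    exact: eq_bigr.
  have -> : secular e K I x * S = \sum_(u in I) (clique_deg e K u)%:R * f u.
    rewrite /secular mulr_suml; apply: eq_bigr => u uI.
    by rewrite [in RHS]fI // expr2; ring.
  by lra.
move=> sec.
(* Conversely, the formulas [fI] and [fK] with [S = 1] define an eigenvector; the secular equation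
   is what makes its clique sum equal to 1. *)
pose g u : R := (clique_deg e K u)%:R / (x * (x + 1) - (clique_deg e K u)%:R).
pose f v := if v \in I then g v else (1 + \sum_(u in I) (e v u)%:R * g u) / (x + 1).
have fI u : u \in I -> f u = g u by rewrite /f => ->.
have fK v : v \in K -> f v = (1 + \sum_(u in I) (e v u)%:R * g u) / (x + 1).
  by move=> vK; rewrite /f (disjointFr dKI vK).
have S1 : \sum_(v in K) f v = 1.
  rewrite (eq_bigr _ fK) -mulr_suml big_split /= sum_clique_sum_independent // sumr_const.
  suff -> : \sum_(u in I) (clique_deg e K u)%:R * g u = secular e K I x.
    by rewrite sec; field.
  by apply: eq_bigr => u _; rewrite /g; ring.
exists f.
  have : \sum_(v in K) f v != 0 by rewrite S1 oner_eq0.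
  case: (pickP (fun z => f z != 0)) => [z fz _|f0]; first by exists z.
  by rewrite big1 ?eqxx // => v _; apply/eqP; move: (f0 v) => /negbFE.
move=> y; have : y \in K :|: I by rewrite KI inE.
case/setUP=> [yK|yI].
  rewrite (sum_clique_nbhd f dsp yK) S1 fK //.
  have -> : \sum_(u in I) (e y u)%:R * f u = \sum_(u in I) (e y u)%:R * g u.
    by apply: eq_bigr => u /fI->.
  by field.
rewrite (sum_independent_nbhd f dsp yI) fI //.
transitivity ((clique_deg e K y)%:R * (1 + g y) / (x + 1)).
  rewrite mulrDr mulr1 -(sum_nbhd_sum_independent g dsp yI) clique_degE -big_split mulr_suml /=.
  by apply: eq_bigr => v vK; rewrite fK //; ring.
by rewrite /g; field; rewrite den.
Qed.

(** * The spectral radius as a root of the secular equation *)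

(** Keeps the denominators of [secular] positive from [k - 1] on: there
    [x (x + 1) >= (k - 1) k >= k > d]. *)
Lemma natr_lt_mul_succ (R : realType) (d k : nat) (x : R) :
  (1 < k)%N -> (d < k)%N -> k%:R - 1 <= x -> d%:R < x * (x + 1).
Proof.
move=> k1 dk kx.
have : (d.+1)%:R <= k%:R :> R by rewrite ler_nat.
have : 2%:R <= k%:R :> R by rewrite ler_nat.
rewrite -natr1; nra.
Qed.

Lemma secular_anti (R : realType) (T : finType) (e : rel T) (K I : {set T})
    (x y : R) :
  (1 < #|K|)%N -> {in I, forall u, (clique_deg e K u < #|K|)%N} ->
  #|K|%:R - 1 <= x -> x <= y -> secular e K I y <= secular e K I x.
Proof.
move=> k1 dk kx xy; apply: ler_sum => u uI.
have dx := natr_lt_mul_succ k1 (dk u uI) kx.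
have dy := natr_lt_mul_succ k1 (dk u uI) (le_trans kx xy).
have : 2%:R <= #|K|%:R :> R by rewrite ler_nat.
move=> k2; apply: ler_wpM2l; first exact: sqr_ge0.
by rewrite lef_pV2 ?posrE; nra.
Qed.

(** Intermediate value theorem on [[k - 1, 2 k]] for the polynomial [P] obtained by clearing
    denominators. *)
Lemma secular_root (R : realType) (T : finType) (e : rel T) (K I : {set T}) :
  disjoint_split e K I -> (1 < #|K|)%N ->
  {in I, forall u, (clique_deg e K u < #|K|)%N} ->
  exists2 x : R, #|K|%:R - 1 <= x & secular e K I x = x + 1 - #|K|%:R.
Proof.
move=> dsp k1 dk; set k : R := #|K|%:R.
have k2 : 2%:R <= k by rewrite ler_nat.
pose d u : R := (clique_deg e K u)%:R.
pose D u : {poly R} := 'X * ('X + 1) - (d u)%:P.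
pose P : {poly R} := ('X + (1 - k)%:P) * \prod_(u in I) D u
  - \sum_(u in I) (d u ^+ 2)%:P * \prod_(u' in I | u' != u) D u'.
have DE x u : (D u).[x] = x * (x + 1) - d u by rewrite !hornerE.
have D0 x : k - 1 <= x -> {in I, forall u, 0 < (D u).[x]}.
  by move=> kx u /dk du; rewrite DE subr_gt0; apply: natr_lt_mul_succ kx.
have PE x : k - 1 <= x ->
    P.[x] = (x + 1 - k - secular e K I x) * \prod_(u in I) (D u).[x].
  move=> kx; rewrite hornerD hornerN hornerM horner_prod horner_sum mulrBl.
  rewrite hornerD hornerX hornerC addrA; congr (_ - _).
  rewrite /secular mulr_suml; apply: eq_bigr => u uI.
  rewrite hornerM hornerC horner_prod [in RHS](bigD1 u) //= mulrA -DE divfK //.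
  by rewrite gt_eqF ?D0.
have prod0 x : k - 1 <= x -> 0 < \prod_(u in I) (D u).[x].
  by move=> kx; apply: prodr_gt0 => u; apply: D0.
have [||x /andP[kx _] /rootP] := @poly_ivt R P (k - 1) (2%:R * k).
- by lra.
- have kk : k - 1 <= 2%:R * k by lra.
  rewrite !PE //; apply/andP; split.
    (* At [k - 1] the linear side is 0 and [secular] is nonnegative. *)
    apply: mulr_le0_ge0; last exact/ltW/prod0.
    suff : 0 <= secular e K I (k - 1) by lra.
    apply: sumr_ge0 => u uI; rewrite divr_ge0 ?sqr_ge0 // -DE ltW ?D0 //.
  (* At [2 k] each denominator is at least [d u], so [secular] is at most the sum of the degrees,
     hence at most [k], while the linear side is [k + 1]. *)
  apply: mulr_ge0; last exact/ltW/prod0.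
  suff : secular e K I (2%:R * k) <= k by lra.
  have /le_trans: secular e K I (2%:R * k) <= \sum_(u in I) d u.
    apply: ler_sum => u uI; rewrite -DE ler_pdivrMr ?D0 // DE expr2.
    have d0 : 0 <= d u by rewrite ler0n.
    have duk : d u <= k by rewrite ler_nat ltnW ?dk.
    by apply: ler_wpM2l => //; nra.
  by apply; rewrite -natr_sum ler_nat sum_clique_deg_le.
rewrite PE // => /eqP; rewrite mulf_eq0 [X in _ || X]gt_eqF ?prod0 // orbF subr_eq0.
by move=> /eqP E; exists x.
Qed.

(** Since [secular] does not increase while [x + 1 - #|K|] strictly increases, no eigenvalue lies
    above the root, which is itself an eigenvalue. *)
Lemma spectral_radius_secular (R : realType) (T : finType) (e : rel T)
    (K I : {set T}) (x : R) :
  disjoint_split e K I -> (1 < #|K|)%N ->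
  {in I, forall u, (clique_deg e K u < #|K|)%N} ->
  #|K|%:R - 1 <= x -> secular e K I x = x + 1 - #|K|%:R ->
  spectral_radius R e = x.
Proof.
move=> dsp k1 dk kx sec.
have k2 : 2%:R <= #|K|%:R :> R by rewrite ler_nat.
have evP y : #|K|%:R - 1 <= y ->
    eigenvalue (adjacency R e) y <-> secular e K I y = y + 1 - #|K|%:R.
  move=> ky; apply: eigenvalue_secular => //; first lra.
  by move=> u /dk du; apply: natr_lt_mul_succ ky.
have evx : eigenvalue (adjacency R e) x by apply/evP.
have ub : ubound [set y : R | eigenvalue (adjacency R e) y]%classic x.
  move=> y evy; rewrite leNgt; apply/negP => xy.
  have /evP : #|K|%:R - 1 <= y by lra.
  move=> /iffLR /(_ evy) secy.
  have := @secular_anti R T e K I x y k1 dk kx (ltW xy).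
  by rewrite sec secy; lra.
apply/eqP; rewrite eq_le; apply/andP; split.
  by apply: ge_sup => //; exists x.
by apply: ub_le_sup => //; exists x.
Qed.

(** * The extremal degree sequence *)

(* With [p d := d^2 / (M - d)], convexity shows up as
   [p d - p 1 = (d - 1) q d] for an increasing [q], so the sum of the [p (d u)]
   is largest when the whole excess sits on one vertex. *)
Lemma extremal_degrees (R : realType) (T : finType) (I : {set T})
    (d : T -> nat) (k : nat) (M : R) :
  let p (c : nat) : R := c%:R ^+ 2 / (M - c%:R) in
  let D := (k - #|I|).+1 in
  (0 < #|I|)%N -> {in I, forall u, (0 < d u)%N} ->
  (\sum_(u in I) d u <= k)%N -> 1 < M -> D%:R < M ->
  (#|I|.-1)%:R * p 1%N + p D <= \sum_(u in I) p (d u) ->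
  exists2 u0, u0 \in I & d u0 = D.
Proof.
move=> p D t0 d1 dk M1 MD pD.
(* The slope of [p] between 1 and [c], with the factor [c - 1] cancelled so that it makes sense at
   [c = 1]. *)
pose q (c : nat) : R := (M * (c%:R + 1) - c%:R) / ((M - c%:R) * (M - 1)).
have pq c : c%:R < M -> p c = p 1%N + (c%:R - 1) * q c.
  by move=> cM; rewrite /p /q; field; apply/andP; split; lra.
have qD0 : 0 < q D.
  rewrite /q divr_gt0 // ?mulr_gt0 ?subr_gt0 //.
  have : 0 <= D%:R :> R by [].
  by nra.
have dI : (\sum_(u in I) d u = \sum_(u in I) (d u).-1 + #|I|)%N.
  rewrite -sum1_card -big_split /=; apply: eq_bigr => u /d1.
  by rewrite addn1 => /prednK.
have dpred u : u \in I -> ((d u).-1 <= \sum_(u in I) (d u).-1)%N.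
  by move=> uI; rewrite (bigD1 u) //= leq_addr.
have dD u : u \in I -> (d u <= D)%N.
  by move=> uI; have := dpred _ uI; have := d1 _ uI; rewrite /D; lia.
have dM u : u \in I -> (d u)%:R < M.
  by move=> uI; apply: le_lt_trans MD; rewrite ler_nat dD.
have qlt u : u \in I -> (d u < D)%N -> q (d u) < q D.
  move=> uI ltD; rewrite /q.
  have l : (d u)%:R < D%:R :> R by rewrite ltr_nat.
  have := dM u uI; have : 0 <= (d u)%:R :> R by [].
  move=> ? ?; rewrite ltr_pdivrMr ?mulr_gt0 ?subr_gt0 // mulrAC.
  rewrite ltr_pdivlMr ?mulr_gt0 ?subr_gt0 //.
  rewrite ![_ * ((M - _) * (M - 1))]mulrA ltr_pM2r ?subr_gt0 //.
  apply: ltr_pM; nra.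
have qle u : u \in I -> q (d u) <= q D.
  by move=> uI; have := dD u uI; rewrite leq_eqVlt => /orP[/eqP->//|/(qlt u uI)/ltW].
have predR u : u \in I -> ((d u).-1)%:R = (d u)%:R - 1 :> R.
  by move=> /d1; case: (d u) => // m _; rewrite -natr1 addrK.
have sumpq : \sum_(u in I) p (d u) = #|I|%:R * p 1%N + \sum_(u in I) ((d u).-1)%:R * q (d u).
  rewrite mulrC mulr_natr -sumr_const -big_split; apply: eq_bigr => u uI /=.
  by rewrite pq ?dM // predR.
have tR : (#|I|.-1)%:R = #|I|%:R - 1 :> R by rewrite -[in RHS](prednK t0) -natr1 addrK.
have DR : D%:R - 1 = (k - #|I|)%:R :> R by rewrite /D -natr1 addrK.
have main : (k - #|I|)%:R * q D <= \sum_(u in I) ((d u).-1)%:R * q (d u).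
  by move: pD; rewrite sumpq tR (pq D) // DR mulrBl mul1r; lra.
(* The excess [k - #|I|] splits into the part used by the degrees and a slack [r]. By [main], the
   slack term plus the losses [(d u - 1) (q D - q (d u))] is at most 0, so each loss vanishes. *)
have sE : ((k - #|I|)%N)%:R * q D = (k - #|I| - \sum_(u in I) (d u).-1)%:R * q D
    + \sum_(u in I) ((d u).-1)%:R * q D.
  rewrite -mulr_suml -natr_sum -mulrDl -natrD; congr (_%:R * _); lia.
have nn u : u \in I -> 0 <= ((d u).-1)%:R * (q D - q (d u)).
  by move=> uI; rewrite mulr_ge0 // subr_ge0 qle.
have sub : \sum_(u in I) ((d u).-1)%:R * (q D - q (d u)) =
    \sum_(u in I) ((d u).-1)%:R * q D - \sum_(u in I) ((d u).-1)%:R * q (d u).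
  by rewrite -sumrB; apply: eq_bigr => u _; rewrite mulrBr.
have snn : 0 <= \sum_(u in I) ((d u).-1)%:R * (q D - q (d u)) by apply: sumr_ge0.
set r := (k - #|I| - \sum_(u in I) (d u).-1)%N in sE.
have rnn : 0 <= r%:R * q D by rewrite mulr_ge0 // ltW.
have /psumr_eq0P z : \sum_(u in I) ((d u).-1)%:R * (q D - q (d u)) = 0.
  by move: main snn; rewrite sE sub; lra.
have [u0 /andP[u0I /eqP du0]|none] := pickP (fun u => (u \in I) && (d u == D)).
  by exists u0.
(* If every degree were below [D], strictness of [q] would force all degrees to be 1; then [main]
   gives [k - #|I| = 0], so [D = 1], a contradiction. *)
have dltD u : u \in I -> (d u < D)%N.
  by move=> uI; have := none u; rewrite uI /= ltn_neqAle dD // andbT => ->.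
have all1 u : u \in I -> (d u).-1 = 0%N.
  move=> uI; have /eqP := z nn u uI; rewrite mulf_eq0 subr_eq0.
  rewrite [X in _ || X]gt_eqF ?qlt ?dltD // orbF.
  by rewrite pnatr_eq0 => /eqP.
have /card_gt0P[u0 u0I] := t0.
have := dltD u0 u0I; have := d1 u0 u0I; rewrite /D.
suff -> : (k - #|I|)%N = 0%N by lia.
have : (k - #|I|)%:R * q D <= 0.
  by apply: (le_trans main); rewrite big1 // => u /all1->; rewrite mul0r.
by rewrite pmulr_lle0 // lern0 => /eqP.
Qed.

(** * Degrees and secular function of [Gnt] *)

Definition Gnt_K (n t : nat) : {set 'I_(n - t) + 'I_t} := [set inl i | i : 'I_(n - t)].

Definition Gnt_I (n t : nat) : {set 'I_(n - t) + 'I_t} := [set inr j | j : 'I_t].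

Lemma card_Gnt_K (n t : nat) : #|Gnt_K n t| = (n - t)%N.
Proof. by rewrite card_imset ?card_ord //; apply: inl_inj. Qed.

Lemma Gnt_disjoint_split (n t : nat) :
  (1 < t)%N -> disjoint_split (Gnt n t) (Gnt_K n t) (Gnt_I n t).
Proof.
move=> t1; split; first exact: Gnt_simple.
- split.
    apply/setP => -[i|j]; rewrite !inE.
      by rewrite (imset_f inl).
    by rewrite orbC (imset_f inr).
  apply/pred0P => x /=; apply/negP => /andP[/imsetP[i _ ->] /imsetP[j _]].
  by [].
- move=> _ _ /imsetP[i _ ->] /imsetP[i' _ ->] /=.
  by rewrite (inj_eq inl_inj).
- by move=> _ _ /imsetP[j _ ->] /imsetP[j' _ ->].
- move=> _ _ _ /imsetP[i _ ->] /imsetP[j _ ->] /imsetP[j' _ ->] /=.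
  move=> h h'; congr inr; apply/val_inj => /=; move: h h'.
  have := ltn_ord j; have := ltn_ord j'; rewrite /Gnt_uv.
  by case: ifP; [lia|]; do 2 case: ifP; lia.
Qed.

Lemma Gnt_clique_deg (n t : nat) (j : 'I_t) :
  (1 < t)%N -> (2 * t <= n)%N ->
  clique_deg (Gnt n t) (Gnt_K n t) (inr j) =
  if (j.+1 < t)%N then 1%N else (n - t - t).+1.
Proof.
move=> t1 tn; rewrite /clique_deg.
have -> : [set v in Gnt_K n t | Gnt n t (inr j) v] =
    [set inl i | i : 'I_(n - t) & Gnt_uv t j.+1 i.+1].
  apply/setP => x; rewrite inE; apply/andP/imsetP.
    by case=> /imsetP[i _ ->] /= h; exists i; rewrite ?inE.
  by case=> i; rewrite inE => h ->; split; rewrite ?imset_f.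
rewrite card_imset; last exact: inl_inj.
rewrite -sum1_card big_mkcond /= /Gnt_uv (negbTE _ : (t == 1%N) = false); last lia.
have := ltn_ord j; case: ifP => jt lj.
  have jn : (j < n - t)%N by lia.
  rewrite (bigD1 (Ordinal jn)) //= inE eqxx big1 // => i ij.
  by rewrite inE eqSS; case: eqP => // E; case/eqP: ij; apply: val_inj.
(* The last vertex [u_t] sees the 0-based indices from [t - 1] up to [n - t - 1]. *)
have tn' : (t.-1 <= n - t)%N by lia.
rewrite (eq_bigr (fun i : 'I_(n - t) => if (t.-1 <= i)%N then 1 else 0)%N); last first.
  by move=> i _; rewrite inE; congr (if _ then _ else _); lia.
rewrite -(big_mkord xpredT (fun i => if (t.-1 <= i)%N then 1 else 0)%N).
rewrite (big_cat_nat (leq0n _) tn') //= big_nat big1 ?add0n; last first.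
  by move=> i /andP[_ it]; rewrite leqNgt it.
rewrite big_nat (eq_bigr (fun=> 1%N)) => [|i /andP[-> _] //].
rewrite -big_nat sum_nat_const_nat muln1; lia.
Qed.

Lemma Gnt_secular (R : realType) (n t : nat) (x : R) :
  (1 < t)%N -> (2 * t <= n)%N ->
  let p (c : nat) : R := c%:R ^+ 2 / (x * (x + 1) - c%:R) in
  secular (Gnt n t) (Gnt_K n t) (Gnt_I n t) x =
    (t.-1)%:R * p 1%N + p (n - t - t).+1.
Proof.
move=> t1 tn p; rewrite /secular big_imset /=; last by move=> ? ? _ _; apply: inr_inj.
rewrite (eq_bigr (fun j : 'I_t => p (if (j.+1 < t)%N then 1 else (n - t - t).+1)%N)); last first.
  by move=> j _; rewrite Gnt_clique_deg.
move: t1; case: (t) => // t' _; rewrite big_ord_recr /= ltnn; congr (_ + _).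
rewrite (eq_bigr (fun=> p 1%N)) => [|j _]; last by rewrite ltnS ltn_ord.
by rewrite sumr_const card_ord mulr_natl.
Qed.

(** * Comparison of the spectral radii *)

(** Let [x] and [y <= x] be the roots for [e] and [Gnt]. At [y] the secular function of [e] is at
    least its value [x + 1 - #|K|] at [x], hence at least [y + 1 - #|K|], the value for [Gnt] at
    [y]. So [extremal_degrees] applies with [M = y (y + 1)]. *)
Lemma spectral_radius_extremal (R : realType) (T : finType) (e : rel T)
    (K I : {set T}) (n : nat) :
  disjoint_split e K I -> (1 < #|I|)%N -> (2 * #|I| <= n)%N ->
  #|K| = (n - #|I|)%N -> {in I, forall u, (0 < clique_deg e K u)%N} ->
  spectral_radius R (Gnt n #|I|) <= spectral_radius R e ->
  exists2 u0, u0 \in I & clique_deg e K u0 = (#|K| - #|I|).+1.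
Proof.
move=> dsp t1 tn kE d1; have k1 : (1 < #|K|)%N by lia.
have sumd := sum_clique_deg_le dsp.
have dk u : u \in I -> (clique_deg e K u < #|K|)%N.
  (* A second vertex of [I] uses up at least one unit of the degree sum. *)
  move=> uI; have /card_gt1P[a [b [aI bI ab]]] := t1.
  have [u' u'I u'u] : exists2 u', u' \in I & u' != u.
    by case: (eqVneq a u) ab => [->|]; [exists b; rewrite // eq_sym | exists a].
  move: sumd; rewrite (bigD1 u) //= (bigD1 u') ?u'I //=.
  by have := d1 u' u'I; lia.
have [x kx xE] := secular_root R dsp k1 dk.
have dsG := @Gnt_disjoint_split n #|I| t1.
have kG1 : (1 < #|Gnt_K n #|I| |)%N by rewrite card_Gnt_K; lia.
have dG u : u \in Gnt_I n #|I| ->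
    (clique_deg (Gnt n #|I|) (Gnt_K n #|I|) u < #|Gnt_K n #|I| |)%N.
  by case/imsetP=> j _ ->; rewrite Gnt_clique_deg // card_Gnt_K; case: ifP; lia.
have [y ky yE] := secular_root R dsG kG1 dG.
rewrite (spectral_radius_secular dsp k1 dk kx xE).
rewrite (spectral_radius_secular dsG kG1 dG ky yE) => yx.
rewrite card_Gnt_K -kE in ky; rewrite Gnt_secular // card_Gnt_K -kE in yE.
apply: (@extremal_degrees R T I _ #|K| (y * (y + 1))) => //.
- exact: ltnW.
- exact: (natr_lt_mul_succ k1 k1 ky).
- by apply: (natr_lt_mul_succ _ _ ky); lia.
have := secular_anti k1 dk ky yx; rewrite xE; apply: le_trans.
by rewrite yE; lra.
Qed.

Local Close Scope ring_scope.

(** * Recognising [Gnt] *)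

(** Reduces an isomorphism to listing [I] and [K] in the order of the [u_j] and [v_i]: [g] is
    injective, hence bijective by counting, and only the edges between [I] and [K] remain to be
    compared. *)
Lemma graph_iso_Gnt_enum (T : finType) (e : rel T) (K I : {set T}) (n t : nat)
    (x0 : T) (us vs : seq T) :
  simple_graph e -> [disjoint K & I] -> clique e K -> independent e I ->
  #|T| = n -> t <= n -> uniq us -> uniq vs -> size us = t -> size vs = n - t ->
  {subset us <= I} -> {subset vs <= K} ->
  (forall i j, i < n - t -> j < t ->
     e (nth x0 us j) (nth x0 vs i) = Gnt_uv t j.+1 i.+1) ->
  graph_iso e (Gnt n t).
Proof.
move=> [se ir] dKI cK iI Tn tn uus uvs sus svs usI vsK euv.
pose g (x : 'I_(n - t) + 'I_t) :=
  match x with inl i => nth x0 vs i | inr j => nth x0 us j end.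
have vK (i : 'I_(n - t)) : nth x0 vs i \in K by apply/vsK/mem_nth; rewrite svs.
have uI (j : 'I_t) : nth x0 us j \in I by apply/usI/mem_nth; rewrite sus.
have ginj : injective g.
  move=> [i|j] [i'|j'] /= E.
  - by congr inl; apply/val_inj/eqP; rewrite /= -(nth_uniq x0 _ _ uvs) ?svs // E.
  - by have := disjointFr dKI (vK i); rewrite E uI.
  - by have := disjointFr dKI (vK i'); rewrite -E uI.
  - by congr inr; apply/val_inj/eqP; rewrite /= -(nth_uniq x0 _ _ uus) ?sus // E.
have [|h hg gh] := inj_card_bij ginj; first by rewrite card_sum !card_ord Tn subnK.
exists h; first by exists g.
have eg x y : e (g x) (g y) = Gnt n t x y.
  case: x y => [i|j] [i'|j'] /=.
  - case: (eqVneq i i') => [->|ii']; first by rewrite ir.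
    by apply: cK; rewrite ?vK // (nth_uniq x0 _ _ uvs) ?svs.
  - by rewrite se euv.
  - by rewrite euv.
  - exact/negbTE/iI.
by move=> x y; rewrite -eg !gh.
Qed.

Lemma graph_iso_Gnt_pendant (T : finType) (e : rel T) (K I : {set T}) (n : nat)
    (u : T) :
  simple_graph e -> [disjoint K & I] -> clique e K -> independent e I ->
  #|T| = n -> #|K| = n - 1 -> 0 < n -> I = [set u] -> clique_deg e K u = 1 ->
  graph_iso e (Gnt n 1).
Proof.
move=> sg dKI cK iI Tn Kn n0 Iu /eqP/cards1P[v nv].
have : v \in [set v in K | e u v] by rewrite nv inE.
rewrite inE => /andP[vK uv].
(* The only neighbour of [u] takes the place of [v_1]. *)
apply: (@graph_iso_Gnt_enum T e K I n 1 u [:: u] (v :: enum (K :\ v))) => //.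
- by rewrite /= mem_enum !inE eqxx enum_uniq.
- by rewrite /= -cardE -Kn (cardsD1 v K) vK.
- by move=> x; rewrite Iu !inE.
- by move=> x; rewrite inE mem_enum !inE => /orP[/eqP->//|/andP[]].
move=> [|i] [|j] //= lti _.
have : nth u (enum (K :\ v)) i \in K :\ v.
  by rewrite -mem_enum mem_nth // -cardE; move: lti; rewrite -Kn (cardsD1 v K) vK.
rewrite !inE => /andP[wv wK]; apply/negP => uw.
have : nth u (enum (K :\ v)) i \in [set v in K | e u v] by rewrite inE wK.
by rewrite nv inE (negbTE wv).
Qed.

(** One neighbour of each other vertex of [I], together with the neighbours of [u0], already
    exhausts [K]; disjointness then determines all edges. *)
Lemma graph_iso_Gnt_extremal (T : finType) (e : rel T) (K I : {set T}) (n : nat)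
    (u0 : T) :
  disjoint_split e K I -> 1 < #|I| -> 2 * #|I| <= n -> #|T| = n ->
  #|K| = n - #|I| -> {in I, forall u, 0 < clique_deg e K u} ->
  u0 \in I -> clique_deg e K u0 = (#|K| - #|I|).+1 ->
  graph_iso e (Gnt n #|I|).
Proof.
case=> sg [KI dKI] cK iI dj t1 tn Tn Kn d1 u0I du0; have [se ir] := sg.
(* The default [u] is never reached on [I], where degrees are positive. *)
pose nb u := odflt u [pick v in [set v in K | e u v]].
have nbP u : u \in I -> nb u \in K /\ e u (nb u).
  move=> uI; rewrite /nb; case: pickP => [v|none] /=.
    by rewrite inE => /andP[].
  by have := d1 u uI; rewrite /clique_deg eq_card0.
have nbE u u' : u \in I -> u' \in I -> e u (nb u') = (u == u').
  move=> uI u'I; have [vK ev] := nbP _ u'I; apply/idP/eqP => [eu|->//].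
  by apply: (dj (nb u')) => //; rewrite se.
set us := enum (I :\ u0).
have usP u : u \in us -> u \in I /\ u != u0 by rewrite mem_enum !inE => /andP[].
have szus : size us = #|I|.-1 by rewrite -cardE (cardsD1 u0 I) u0I.
set N0 := enum [set v in K | e u0 v].
have N0P v : v \in N0 -> v \in K /\ e u0 v by rewrite mem_enum inE => /andP[].
have szN0 : size N0 = (#|K| - #|I|).+1 by rewrite -cardE.
(* [u0] plays [u_t], so it comes last, and its neighbours follow the chosen ones. *)
apply: (@graph_iso_Gnt_enum T e K I n #|I| u0 (rcons us u0) (map nb us ++ N0)) => //.
- lia.
- by rewrite rcons_uniq mem_enum !inE eqxx enum_uniq.
- rewrite cat_uniq map_inj_in_uniq ?enum_uniq /= => [|u u' /usP[uI _] /usP[u'I _] E].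
    rewrite andbT; apply/hasPn => v /N0P[vK ev]; apply/mapP => -[u /usP[uI uu0] E].
    by move: ev; rewrite E nbE // eq_sym (negbTE uu0).
  by apply/eqP; rewrite -nbE // -E; have [] := nbP _ uI.
- by rewrite size_rcons szus; lia.
- by rewrite size_cat size_map szus szN0; lia.
- by move=> u; rewrite mem_rcons inE => /orP[/eqP->//|/usP[]].
- by move=> v; rewrite mem_cat => /orP[/mapP[u /usP[/nbP[]] ? _ _ ->]|/N0P[]].
move=> i j lti ltj.
rewrite nth_rcons nth_cat size_map szus /Gnt_uv.
have -> : (#|I| == 1) = false by lia.
have nthus m : m < #|I|.-1 -> nth u0 us m \in I /\ nth u0 us m != u0.
  by move=> lm; apply/usP/mem_nth; rewrite szus.
have nthN m : m < (#|K| - #|I|).+1 -> nth u0 N0 m \in K /\ e u0 (nth u0 N0 m).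
  by move=> lm; apply/N0P/mem_nth; rewrite szN0.
case: (ltnP j #|I|.-1) => lj; case: (ltnP i #|I|.-1) => li.
- have [? _] := nthus _ li; have [? _] := nthus _ lj.
  rewrite (nth_map u0) ?szus // nbE // nth_uniq ?szus ?enum_uniq //.
  have -> : j.+1 < #|I| by lia.
  by rewrite eqSS eq_sym.
- have [? un] := nthus _ lj.
  have [|vK ev] := nthN (i - #|I|.-1); first lia.
  have -> : j.+1 < #|I| by lia.
  have -> : (i.+1 == j.+1) = false by lia.
  apply/negP => ev'; case/eqP: un.
  by apply: (dj (nth u0 N0 (i - #|I|.-1))) => //; rewrite se.
- have [? un] := nthus _ li.
  have -> : j == #|I|.-1 by lia.
  have -> : (j.+1 < #|I|) = false by lia.
  have -> : (#|I| <= i.+1) = false by lia.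
  by rewrite (nth_map u0) ?szus // nbE // eq_sym (negbTE un).
- have -> : j == #|I|.-1 by lia.
  have -> : (j.+1 < #|I|) = false by lia.
  have -> : #|I| <= i.+1 by lia.
  by have [|_ ->] := nthN (i - #|I|.-1); first lia.
Qed.

(** * Hamiltonian cycles closed through the clique *)

Lemma clique_path (T : finType) (e : rel T) (K : {set T}) (x : T) (s : seq T) :
  clique e K -> x \in K -> {subset s <= K} -> uniq (x :: s) -> path e x s.
Proof.
move=> cK; elim: s x => //= y s IH x xK sK /and3P[xys ys us].
have yK : y \in K by apply: sK; rewrite inE eqxx.
rewrite cK //=; last by apply: contraNneq xys => ->; rewrite inE eqxx.
by apply: IH; rewrite /= ?ys // => z zs; apply: sK; rewrite inE zs orbT.
Qed.

Lemma hamiltonian_uniq_cycle (T : finType) (e : rel T) (c : seq T) :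
  2 < #|T| -> cycle e c -> uniq c -> (forall x, x \in c) -> hamiltonian e.
Proof.
move=> T2 ec uc allc; exists c; split=> //; last by apply/andP.
apply: (leq_trans T2); have <- : #|c| = #|T| by apply: eq_card.
exact: card_size.
Qed.

(* The clique vertices missed by the path close it up to a Hamiltonian cycle. *)
Lemma hamiltonian_of_path (T : finType) (e : rel T) (K I : {set T}) (x : T)
    (p : seq T) :
  2 < #|T| -> K :|: I = [set: T] -> clique e K -> x \in K -> last x p \in K ->
  0 < size p -> path e x p -> uniq (x :: p) -> {subset I <= x :: p} ->
  hamiltonian e.
Proof.
move=> T2 KI cK xK lK p0 ep up Ip.
pose r := [seq v <- enum K | v \notin x :: p].
have rP v : (v \in r) = (v \notin x :: p) && (v \in K) by rewrite mem_filter mem_enum.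
have lx : last x p != x.
  by case: p p0 up {lK ep Ip r rP} => //= y q _ /andP[xq _]; apply: contraNneq xq => <-; apply: mem_last.
apply: (@hamiltonian_uniq_cycle T e (x :: p ++ r)) => //.
(* From [last x p] the cycle returns through [r] to [x] inside the clique. *)
- rewrite /= rcons_cat cat_path ep /=; apply: (clique_path cK lK).
    by move=> v; rewrite mem_rcons inE rP => /orP[/eqP->|/andP[]].
  rewrite cons_uniq mem_rcons inE negb_or lx rP mem_last /= rcons_uniq rP inE eqxx /=.
  by rewrite filter_uniq ?enum_uniq.
- rewrite -cat_cons cat_uniq up filter_uniq ?enum_uniq // andbT.
  by apply/hasPn => v; rewrite rP => /andP[].
- move=> v; rewrite -cat_cons mem_cat rP; case vp: (v \in x :: p) => //=.
  have : v \in K :|: I by rewrite KI inE.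
  by case/setUP=> // /Ip; rewrite vp.
Qed.

(** * Consequences of claw-freeness *)

Lemma claw_free_star3 (T : finType) (e : rel T) (c x y z : T) :
  simple_graph e -> claw_free e -> e c x -> e c y -> e c z ->
  x != y -> x != z -> y != z -> [|| e x y, e x z | e y z].
Proof.
move=> [se ir] cf cx cy cz xy xz yz; apply/negPn/negP; rewrite !negb_or.
move=> /and3P[nxy nxz nyz]; apply: cf.
have neq a b : e a b -> a != b by apply: contraTneq => ->; rewrite ir.
pose s := [:: c; x; y; z].
have us : uniq s by rewrite /= !inE !negb_or xy xz yz (neq _ _ cx) (neq _ _ cy) (neq _ _ cz).
exists (fun i : 'I_4 => nth c s i).
  by move=> i j /eqP; rewrite nth_uniq // => /eqP/val_inj.
have sE := (ir, cx, cy, cz, (se x c, se y c, se z c), (se y x, se z x, se z y),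
  (negbTE nxy, negbTE nxz, negbTE nyz)).
by move=> [[|[|[|[|i]]]] ?] [[|[|[|[|j]]]] ?] //=; rewrite !sE.
Qed.

(** Otherwise [u] could be added to [K], against maximality. *)
Lemma independent_nonnbr (T : finType) (e : rel T) (K I : {set T}) (u : T) :
  simple_graph e -> split_graph e K I -> u \in I ->
  exists2 a, a \in K & ~~ e a u.
Proof.
move=> [se ir] [KI dKI [cK mK] iI] uI.
have [a /andP[aK na]|full] := pickP (fun a => (a \in K) && ~~ e a u).
  by exists a.
have uK : u \notin K by rewrite (disjointFl dKI uI).
have {}full a : a \in K -> e a u by move=> aK; have := full a; rewrite aK /= => /negbFE.
have /mK : clique e (u |: K).
  move=> x y /setU1P[->|xK] /setU1P[->|yK]; rewrite ?eqxx // => xy.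
  - by rewrite se full.
  - exact: full.
  - exact: cK.
by rewrite cardsU1 uK ltnn.
Qed.

(** Otherwise [v] would be the centre of a claw with leaves [w], [u], [u']. *)
Lemma claw_free_cover (T : finType) (e : rel T) (K I : {set T}) (v u u' w : T) :
  simple_graph e -> split_graph e K I -> claw_free e ->
  v \in K -> u \in I -> u' \in I -> u != u' -> e v u -> e v u' -> w \in K ->
  e w u || e w u'.
Proof.
move=> sg [KI dKI [cK _] iI] cf vK uI u'I uu' vu vu' wK.
case: (eqVneq v w) => [<-|vw]; first by rewrite vu.
have wI x : x \in I -> w != x by move=> xI; apply: contraTneq wK => ->; rewrite (disjointFl dKI).
have := claw_free_star3 sg cf (cK _ _ vK wK vw) vu vu' (wI _ uI) (wI _ u'I) uu'.
by rewrite (negbTE (iI _ _ uI u'I)) orbF.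
Qed.

Lemma claw_free_two_nbrs (T : finType) (e : rel T) (I : {set T})
    (v x y z : T) :
  simple_graph e -> independent e I -> claw_free e ->
  x \in I -> y \in I -> z \in I -> x != y -> x != z -> y != z ->
  e v x -> e v y -> ~~ e v z.
Proof.
move=> sg iI cf xI yI zI xy xz yz vx vy; apply/negP => vz.
by have := claw_free_star3 sg cf vx vy vz xy xz yz; rewrite !(negbTE (iI _ _ _ _)).
Qed.

(** A non-neighbour [b] of [u1] in [K] sees [u2] and [u3], which yields the 6-cycle [v u2 b u3 w u1]
    through all of [I]. *)
Lemma hamiltonian_three_shared (T : finType) (e : rel T) (K I : {set T})
    (u1 u2 u3 v w : T) :
  simple_graph e -> split_graph e K I -> claw_free e -> 2 < #|T| ->
  {in I, forall u, exists2 v, v \in K & e v u} ->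
  u1 \in I -> u2 \in I -> u3 \in I -> u1 != u2 -> u1 != u3 -> u2 != u3 ->
  v \in K -> w \in K -> e v u1 -> e v u2 -> e w u1 -> e w u3 -> hamiltonian e.
Proof.
move=> sg sp cf T2 nb I1 I2 I3 u12 u13 u23 vK wK v1 v2 w1 w3.
have [se ir] := sg; have [KI dKI [cK _] iI] := sp.
have KIn x u : x \in K -> u \in I -> (x == u) = false.
  by move=> xK uI; apply: contraTF xK => /eqP->; rewrite (disjointFl dKI).
have c12 x : x \in K -> e x u1 || e x u2 by apply: (claw_free_cover sg sp cf vK).
have c13 x : x \in K -> e x u1 || e x u3 by apply: (claw_free_cover sg sp cf wK).
have [b bK b1] := independent_nonnbr sg sp I1.
have b2 : e b u2 by have := c12 b bK; rewrite (negbTE b1).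
have b3 : e b u3 by have := c13 b bK; rewrite (negbTE b1).
have c23 x : x \in K -> e x u2 || e x u3 by apply: (claw_free_cover sg sp cf bK).
have v3 : ~~ e v u3 by apply: (claw_free_two_nbrs sg iI cf I1 I2 I3).
have w2 : ~~ e w u2 by apply: (claw_free_two_nbrs sg iI cf I1 I3 I2); rewrite // eq_sym.
have vb : v != b by apply: contraNneq b1 => <-.
have wb : w != b by apply: contraNneq b1 => <-.
have vw : v != w by apply: contraNneq w2 => <-.
(* Every clique vertex sees two of [u1], [u2], [u3], so a neighbour [y] of a fourth vertex of [I]
   would be the centre of a claw. *)
have I3P u : u \in I -> [|| u == u1, u == u2 | u == u3].
  move=> uI; apply/negPn/negP; rewrite !negb_or => /and3P[n1 n2 n3].
  have [y yK yu] := nb _ uI.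
  have no a c : a \in I -> c \in I -> a != c -> u != a -> u != c -> e y a -> ~~ e y c.
    by move=> aI cI ac ua uc ya; apply: (claw_free_two_nbrs sg iI cf uI aI).
  have n12 := no _ _ I1 I2 u12 n1 n2.
  have n13 := no _ _ I1 I3 u13 n1 n3.
  have n23 := no _ _ I2 I3 u23 n2 n3.
  case/orP: (c12 y yK) => [y1|y2].
    by case/orP: (c23 y yK); apply/negP; [apply: n12 | apply: n13].
  case/orP: (c13 y yK) => [y1|]; last exact/negP/n23.
  by move: (n12 y1); rewrite y2.
have nKI x (xK : x \in K) := (KIn x u1 xK I1, KIn x u2 xK I2, KIn x u3 xK I3,
  eq_sym u1 x, eq_sym u2 x, eq_sym u3 x).
have u21 : u2 != u1 by rewrite eq_sym.
have u31 : u3 != u1 by rewrite eq_sym.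
have u32 : u3 != u2 by rewrite eq_sym.
have bv : b != v by rewrite eq_sym.
have bw : b != w by rewrite eq_sym.
have wv : w != v by rewrite eq_sym.
(* A further clique vertex [x] sees [u1] or [u2]; the 6-cycle is cut after that vertex and continued
   to [x]. Without such an [x] the 6-cycle is Hamiltonian. *)
have [x /and4P[xK xv xb xw]|none] :=
    pickP (fun x => [&& x \in K, v != x, b != x & w != x]).
  case x1: (e x u1).
    apply: (@hamiltonian_of_path T e K I v [:: u2; b; u3; w; u1; x]) => //.
    - by rewrite /= v2 se b2 b3 (se u3) w3 w1 se x1.
    - by rewrite /= !inE !negb_or !(nKI v vK, nKI b bK, nKI w wK, nKI x xK) /= vb vw xv u23 u21 bw xb u31 xw.
    - by move=> u /I3P/or3P[]/eqP->; rewrite !inE eqxx ?orbT.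
  have x2 : e x u2 by have := c12 x xK; rewrite x1.
  apply: (@hamiltonian_of_path T e K I b [:: u3; w; u1; v; u2; x]) => //.
  - by rewrite /= b3 se w3 w1 (se u1) v1 v2 se x2.
  - by rewrite /= !inE !negb_or !(nKI v vK, nKI b bK, nKI w wK, nKI x xK) /= bv bw xv u12 u31 u32 wv xb xw.
  - by move=> u /I3P/or3P[]/eqP->; rewrite !inE eqxx ?orbT.
apply: (@hamiltonian_uniq_cycle T e [:: v; u2; b; u3; w; u1]) => //.
- by rewrite /= v2 se b2 b3 (se u3) w3 w1 se v1.
- by rewrite /= !inE !negb_or !(nKI v vK, nKI b bK, nKI w wK) /= vb vw u23 u21 bw u31.
move=> x; have : x \in K :|: I by rewrite KI inE.
case/setUP=> [xK|/I3P/or3P[]/eqP->]; rewrite !inE ?eqxx ?orbT //.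
have := none x; rewrite xK /= !(eq_sym _ x).
by case: (x == v); case: (x == b); case: (x == w); rewrite ?orbT.
Qed.

Lemma claw_free_split_dichotomy (T : finType) (e : rel T) (K I : {set T}) :
  simple_graph e -> split_graph e K I -> claw_free e -> 2 < #|T| ->
  {in I, forall u, exists2 v, v \in K & e v u} ->
  hamiltonian e \/ disjoint_split e K I.
Proof.
move=> sg sp cf T2 nb; have [se ir] := sg; have [KI dKI [cK _] iI] := sp.
have [[[v u] u'] /=|none] := pickP (fun x : T * T * T =>
    [&& x.1.1 \in K, x.1.2 \in I, x.2 \in I, x.1.2 != x.2 &
        e x.1.1 x.1.2 && e x.1.1 x.2]); last first.
  right; split=> // v u u' vK uI u'I vu vu'; apply/eqP.
  by have := none (v, u, u'); rewrite /= vK uI u'I vu vu' /= andbT => /negbFE.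
case/and5P=> vK uI u'I uu' /andP[vu vu']; left.
have cov x : x \in K -> e x u || e x u' by apply: (claw_free_cover sg sp cf vK).
have [u3 /and3P[I3 n3 n3']|none] := pickP (fun x => [&& x \in I, u != x & u' != x]).
  (* By covering, a neighbour [w] of the third vertex also sees [u] or [u']. *)
  have [w wK w3] := nb _ I3; have /orP[wu|wu'] := cov w wK.
    exact: (@hamiltonian_three_shared T e K I u u' u3 v w).
  by apply: (@hamiltonian_three_shared T e K I u' u u3 v w) => //; rewrite eq_sym.
(* Now [I] is [{u, u'}]; by covering, [a] sees [u] and [b] sees [u'], giving the path
   [a u v u' b]. *)
have [a aK au'] := independent_nonnbr sg sp u'I.
have [b bK bu] := independent_nonnbr sg sp uI.
have au : e a u by have := cov a aK; rewrite (negbTE au') orbF.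
have bu' : e b u' by have := cov b bK; rewrite (negbTE bu).
have KIn x y : x \in K -> y \in I -> (x == y) = false.
  by move=> xK yI; apply: contraTF xK => /eqP->; rewrite (disjointFl dKI).
have nKI x (xK : x \in K) := (KIn x u xK uI, KIn x u' xK u'I, eq_sym u x, eq_sym u' x).
have av : a != v by apply: contraNneq au' => ->.
have ab : a != b by apply: contraNneq au' => ->.
have vb : v != b by apply: contraNneq bu => <-.
apply: (@hamiltonian_of_path T e K I a [:: u; v; u'; b]) => //.
- by rewrite /= au se vu vu' se bu'.
- by rewrite /= !inE !negb_or !(nKI v vK, nKI a aK, nKI b bK) /= av ab uu' vb.
move=> x xI; rewrite !inE; have := none x; rewrite xI /= !(eq_sym _ x).
by case: (x == u); case: (x == u'); rewrite ?orbT.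
Qed.

(** * Connectedness and the case split on the size of [I] *)

Lemma connected_independent_nbr (T : finType) (e : rel T) (K I : {set T}) :
  simple_graph e -> split_graph e K I -> connected_graph e -> 1 < #|T| ->
  {in I, forall u, exists2 v, v \in K & e v u}.
Proof.
move=> [se ir] [KI dKI _ iI] cn T1 u uI.
have [y yu] : exists y, y != u.
  have /card_gt1P[a [b [_ _ ab]]] : 1 < #|[set: T]| by rewrite cardsT.
  by case: (eqVneq a u) ab => [->|]; [exists b; rewrite eq_sym | exists a].
case/connectP: (cn u y) => [[|v p] /=]; first by move=> _ E; rewrite E eqxx in yu.
move=> /andP[uv _] _; exists v; last by rewrite se.
have : v \in K :|: I by rewrite KI inE.
by case/setUP=> // vI; move: uv; rewrite (negbTE (iI _ _ uI vI)).
Qed.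

Theorem theorem3 (R : realType) (T : finType) (e : rel T) (K I : {set T})
    (n : nat) :
  simple_graph e -> split_graph e K I -> connected_graph e -> claw_free e ->
  #|T| = n -> 1 <= #|I| -> maxn 4 (2 * #|I|) <= n ->
  (spectral_radius R (Gnt n #|I|) <= spectral_radius R e)%R ->
  hamiltonian e \/ graph_iso e (Gnt n #|I|).
Proof.
move=> sg sp cn cf Tn I1; rewrite geq_max => /andP[n4 tn] rho.
have [KI dKI [cK _] iI] := sp; have [se ir] := sg.
have T2 : 2 < #|T| by lia.
have nb := connected_independent_nbr sg sp cn (ltnW T2).
have [|dsp] := claw_free_split_dichotomy sg sp cf T2 nb; first by left.
have Kn : #|K| = n - #|I|.
  by rewrite -Tn -cardsT -KI cardsU disjoint_setI0 // cards0 subn0 addnK.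
have d1 : {in I, forall u, 0 < clique_deg e K u}.
  by move=> u /nb[v vK vu]; apply/card_gt0P; exists v; rewrite inE vK se.
move: I1; rewrite leq_eqVlt => /orP[/eqP/esym t1|t2]; last first.
  have [u0 u0I du0] := spectral_radius_extremal dsp t2 tn Kn d1 rho.
  by right; apply: (graph_iso_Gnt_extremal dsp) du0.
(* With [I = {u}], degree 1 gives [Gnt n 1], and two neighbours [a], [b] give the path [a u b],
   closed through the clique. *)
have /eqP/cards1P[u Iu] := t1.
have uI : u \in I by rewrite Iu inE.
have := d1 u uI; rewrite leq_eqVlt => /orP[/eqP/esym du|d2].
  right; rewrite t1; apply: (graph_iso_Gnt_pendant sg dKI cK iI Tn _ _ Iu du); lia.
left; have /card_gt1P[a [b []]] := d2; rewrite !inE => /andP[aK ua] /andP[bK ub] ab.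
have KIn x : x \in K -> x != u by move=> xK; apply: contraTneq xK => ->; rewrite (disjointFl dKI).
apply: (@hamiltonian_of_path T e K I a [:: u; b]) => //.
- by rewrite /= se ua ub.
- by rewrite /= !inE !negb_or KIn // ab eq_sym KIn.
- by move=> x; rewrite Iu !inE => ->; rewrite orbT.
Qed.
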